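(* For every integer $k\geq 2$ there exists a finite, simple, connected graph of order $\lceil \frac{5k}{2}+1\rceil$ which has metric dimension $k$ and exactly one metric basis.
   Context: For vertices $u,v$ of a connected graph $G$, $d(u,v)$ is the distance between them. For an ordered set $W=\{w_1,\dots,w_k\}\subseteq V(G)$ and $v\in V(G)$, $r(v|W)=(d(v,w_1),\dots,d(v,w_k))$. $W$ is a resolving set if distinct vertices have distinct representations $r(\cdot|W)$. A resolving set of minimum cardinality is a metric basis; its cardinality is the metric dimension $\beta(G)$. *)

(* Defs.v *)
From mathcomp Require Import all_boot.

Set Implicit Arguments.
Unset Strict Implicit.
Unset Printing Implicit Defensive.

Section MetricDimension.

Variables (T : finType) (e : rel T).
Implicit Types (x y v : T) (W : {set T}).

Definition connected_graph := forall x y, connect e x y.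

Definition walk_of_length n x y : bool :=
  [exists p : n.-tuple T, path e x p && (last x p == y)].

(* Geodesics have length < #|T|, so it is enough to search the lengths        *)
(* 0, ..., #|T| - 1; the value is #|T| when x and y are not connected.        *)
Definition dist x y : nat :=
  find (fun n => walk_of_length n x y) (iota 0 #|T|).

Lemma walk_of_lengthP n x y :
  reflect (exists p : seq T, [/\ size p = n, path e x p & last x p = y])
          (walk_of_length n x y).
Proof.
apply: (iffP existsP) => [[p /andP[ep /eqP lp]] | [p [/eqP sp ep lp]]].
  by exists p; rewrite size_tuple.
by exists (Tuple sp); rewrite /= ep lp eqxx.
Qed.

Lemma dist_min n x y : walk_of_length n x y -> dist x y <= n.
Proof.
move=> nxy; rewrite /dist leqNgt; apply/negP => ltn.
have /(before_find 0) := ltn; rewrite nth_iota ?add0n ?nxy //.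
by apply: leq_trans ltn _; rewrite -[X in _ <= X](size_iota 0) find_size.
Qed.

Lemma dist_walk x y : connect e x y -> walk_of_length (dist x y) x y.
Proof.
move=> /connectP[p0 ep0 ->]; case/shortenP: ep0 => p ep up _.
have sp : size p < #|T|.
  by move/card_uniqP: up => /= <-; apply: max_card.
have has_w : has (fun n => walk_of_length n x (last x p)) (iota 0 #|T|).
  apply/hasP; exists (size p); first by rewrite mem_iota.
  by apply/walk_of_lengthP; exists p.
have := nth_find 0 has_w.
by rewrite nth_iota // -[X in _ < X](size_iota 0) -has_find.
Qed.

(* The elements of W are listed in the order of [enum]; whether W resolves    *)
(* the graph does not depend on the chosen order.                             *)
Definition representation W v : seq nat := [seq dist v w | w <- enum W].

Definition resolving W : bool := injectiveb (representation W).

Definition metric_basis W : bool :=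
  resolving W && [forall W' : {set T}, resolving W' ==> (#|W| <= #|W'|)].

(* The default [set: T] is resolving, by [resolving_setT] below.              *)
Definition metric_dimension : nat :=
  #|[arg min_(W < [set: T] | resolving W) #|W| ]|.

Lemma resolvingP W :
  reflect (forall u v, {in W, forall w, dist u w = dist v w} -> u = v)
          (resolving W).
Proof.
apply: (iffP (injectiveP (representation W))) => rW u v.
  move=> uv; apply: rW; apply/eq_in_map => w; rewrite mem_enum; exact: uv.
move/eq_in_map => uv; apply: rW => w wW; apply: uv; by rewrite mem_enum.
Qed.

Lemma resolving_setT : resolving [set: T].
Proof.
have d0 x : dist x x = 0.
  apply/eqP; rewrite -leqn0; apply: dist_min.
  by apply/walk_of_lengthP; exists [::].
apply/resolvingP => u v /(_ v (in_setT _)); rewrite d0 => duv.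
have card0 : 0 < #|T| by apply/card_gt0P; exists u.
have hasw : has (fun n => walk_of_length n u v) (iota 0 #|T|).
  by rewrite has_find size_iota -/(dist u v) duv.
have := nth_find 0 hasw; rewrite -/(dist u v) duv nth_iota //.
by move=> /walk_of_lengthP[p [/size0nil-> _ /= ->]].
Qed.

Lemma metric_basis_card W :
  metric_basis W = resolving W && (#|W| == metric_dimension).
Proof.
rewrite /metric_basis /metric_dimension.
case: arg_minnP => [|B rB minB]; first exact: resolving_setT.
case rW: (resolving W) => //=; apply/forallP/eqP => [minW | -> W'].
  by apply/eqP; rewrite eqn_leq (minB _ rW) andbT; apply: (implyP (minW B)).
by apply/implyP; apply: minB.
Qed.

End MetricDimension.

(* Main.v *)
Require Import Defs.
From mathcomp Require Import all_boot all_order all_algebra.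
From mathcomp Require Import zify lra.

Import Order.TTheory GRing.Theory Num.Theory.

(* Add a universal vertex to the complement of a graph F. All distances are   *)
(* at most 2, so resolving sets of the cone correspond to locating-dominating *)
(* sets of F: the apex, at distance 1 from everything, has to be told apart   *)
(* from the other vertices, which forces domination unless the apex itself is *)
(* chosen. Locating-domination is additive under disjoint unions, so F can be *)
(* assembled from small pieces with a unique optimal set. The path on 5       *)
(* vertices has one of size 2, namely the two neighbours of its ends, and the *)
(* path on 7 vertices with a pendant vertex at its middle has one of size 3.  *)
(* Taking k/2 copies of the former, or (k-3)/2 copies together with one of    *)
(* the latter, gives F of order 5k/2, resp. (5k+1)/2.                         *)

Set Implicit Arguments.
Unset Strict Implicit.
Unset Printing Implicit Defensive.

(** Uniqueness is carried by one sharp inequality: [W0] is tight if each locating set [W] satisfies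
    [#|W0| <= #|W| + ~~ dominating W], with equality only at [W0]. A resolving set of the cone has a
    locating trace on F, and it contains the apex unless that trace dominates, so its size is at
    least the right-hand side; hence a tight set is the only basis ([co_cone_unique_basis]).
    Tightness survives disjoint unions ([sum_tight_locating_dominating]), and for the two small
    pieces it is a finite check. *)

Section LocatingDominating.

Variables (T : finType) (F : rel T).
Implicit Types (u v w : T) (W : {set T}).

Definition dominating W := [forall u, (u \in W) || [exists w in W, F u w]].

Definition locating W :=
  [forall u, forall v,
     [&& u \notin W, v \notin W & [forall w in W, F u w == F v w]] ==> (u == v)].

(* The correction term [~~ dominating F W] accounts for resolving sets of the *)
(* cone that contain the apex: these need not dominate F.                     *)
Definition tight_locating_dominating W0 :=
  [/\ locating W0, dominating W0 &
      forall W, locating W ->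
        #|W0| <= #|W| + ~~ dominating W ?= iff (W == W0)].

Lemma dominatingP W :
  reflect (forall u, u \notin W -> exists2 w, w \in W & F u w) (dominating W).
Proof.
apply: (iffP forallP) => domW u; last first.
  by case: (boolP (u \in W)) => //= /domW[w wW Fuw]; apply/exists_inP; exists w.
by move=> uW; have := domW u; rewrite (negbTE uW) => /exists_inP.
Qed.

Lemma locatingP W :
  reflect (forall u v, u \notin W -> v \notin W ->
             {in W, forall w, F u w = F v w} -> u = v)
          (locating W).
Proof.
apply: (iffP forallP) => [locW u v uW vW Fuv | locW u].
  have /forallP/(_ v) := locW u; rewrite uW vW /= => /implyP Huv.
  by apply/eqP/Huv/forall_inP => w wW; rewrite Fuv.
apply/forallP => v; apply/implyP => /and3P[uW vW /forall_inP Fuv].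
by apply/eqP/locW => // w wW; apply/eqP/Fuv.
Qed.

End LocatingDominating.

(** * Additivity under disjoint union *)

Section DisjointUnion.

Variables (T1 T2 : finType) (F1 : rel T1) (F2 : rel T2).

Definition sum_rel : rel (T1 + T2) := fun u v =>
  match u, v with
  | inl x, inl y => F1 x y
  | inr x, inr y => F2 x y
  | _, _ => false
  end.

Lemma card_sum_set (W : {set T1 + T2}) :
  #|W| = #|inl @^-1: W| + #|inr @^-1: W|.
Proof.
rewrite -!sum1_card big_sumType /=.
by congr (_ + _); apply: eq_bigl => x; rewrite inE.
Qed.

Lemma sum_rel_dominating (W : {set T1 + T2}) :
  dominating sum_rel W =
    dominating F1 (inl @^-1: W) && dominating F2 (inr @^-1: W).
Proof.
apply/dominatingP/andP => [domW | [/dominatingP dom1 /dominatingP dom2]].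
  split; apply/dominatingP => u; rewrite inE => /domW[[] w wW // Fuw];
  by exists w; rewrite ?inE.
case=> u uW.
  by have [|w] := dom1 u; rewrite !inE // => wW Fuw; exists (inl w).
by have [|w] := dom2 u; rewrite !inE // => wW Fuw; exists (inr w).
Qed.

(* Undominated vertices on the two sides would both see nothing of W.         *)
Lemma sum_rel_locating (W : {set T1 + T2}) :
  locating sum_rel W =
    [&& locating F1 (inl @^-1: W), locating F2 (inr @^-1: W) &
        dominating F1 (inl @^-1: W) || dominating F2 (inr @^-1: W)].
Proof.
apply/locatingP/and3P => [locW | [/locatingP loc1 /locatingP loc2 dom12]].
  split.
  - apply/locatingP => u v; rewrite !inE => uW vW Fuv.
    suff [] : inl u = inl v :> T1 + T2 by [].
    by apply: locW => // -[] w wW //=; apply: Fuv; rewrite inE.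
  - apply/locatingP => u v; rewrite !inE => uW vW Fuv.
    suff [] : inr u = inr v :> T1 + T2 by [].
    by apply: locW => // -[] w wW //=; apply: Fuv; rewrite inE.
  apply/contraT; rewrite negb_or => /andP[/forallPn[u] + /forallPn[v]].
  rewrite !inE !negb_or => /andP[uW nFu] /andP[vW nFv].
  suff : inl u = inr v :> T1 + T2 by [].
  apply: locW => // -[] w wW /=.
    by apply: contraNF nFu => Fuw; apply/exists_inP; exists w; rewrite ?inE.
  apply/esym; apply: contraNF nFv => Fvw.
  by apply/exists_inP; exists w; rewrite ?inE.
have cross u v : inl u \notin W -> inr v \notin W ->
    {in W, forall w, sum_rel (inl u) w = sum_rel (inr v) w} -> False.
  move=> uW vW Fuv; case/orP: dom12 => /dominatingP dom.
    have [|w] := dom u; rewrite !inE // => wW.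
    by have /= -> := Fuv _ wW.
  have [|w] := dom v; rewrite !inE // => wW.
  by have /= <- := Fuv _ wW.
case=> u [] v uW vW Fuv.
- congr inl; apply: loc1; rewrite ?inE // => w; rewrite inE.
  by move/Fuv.
- by case: (cross u v).
- by case: (cross v u) => // w wW; rewrite Fuv.
- congr inr; apply: loc2; rewrite ?inE // => w; rewrite inE.
  by move/Fuv.
Qed.

(** A locating set of the union fails to dominate on at most one side, so the two correction terms
    add up to that of the union, and the two inequalities can be added together with their equality
    cases. *)
Lemma sum_tight_locating_dominating (W1 : {set T1}) (W2 : {set T2}) :
    tight_locating_dominating F1 W1 -> tight_locating_dominating F2 W2 ->
  exists2 W, tight_locating_dominating sum_rel W & #|W| = #|W1| + #|W2|.
Proof.
move=> [loc1 dom1 min1] [loc2 dom2 min2].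
pose W := [set u | match u with inl x => x \in W1 | inr x => x \in W2 end].
have W1E : inl @^-1: W = W1 by apply/setP => x; rewrite !inE.
have W2E : inr @^-1: W = W2 by apply/setP => x; rewrite !inE.
have cardW : #|W| = #|W1| + #|W2| by rewrite card_sum_set W1E W2E.
exists W => //; split.
- by rewrite sum_rel_locating W1E W2E loc1 loc2 dom1.
- by rewrite sum_rel_dominating W1E W2E dom1 dom2.
move=> V; rewrite sum_rel_locating sum_rel_dominating (card_sum_set V).
case/and3P => /min1 le1 /min2 le2 dom12.
have -> : (V == W) = (inl @^-1: V == W1) && (inr @^-1: V == W2).
  apply/eqP/andP => [-> | [/eqP V1E /eqP V2E]]; first by rewrite W1E W2E !eqxx.
  by apply/setP => -[] x; rewrite inE -?V1E -?V2E inE.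
have := leqif_add le1 le2; rewrite -cardW addnACA.
by case/orP: dom12 => ->; rewrite ?andbT /= ?addn0 ?add0n.
Qed.

End DisjointUnion.

Lemma sum_rel_sym (T1 T2 : finType) (F1 : rel T1) (F2 : rel T2) :
  symmetric F1 -> symmetric F2 -> symmetric (sum_rel F1 F2).
Proof. by move=> sym1 sym2 [] x [] y /=. Qed.

(** * The cone over the complement and its resolving sets *)

Lemma dist_universal (T : finType) (e : rel T) (c : T) :
    symmetric e -> (forall x, x != c -> e x c) ->
  forall x y, dist e x y = if x == y then 0 else if e x y then 1 else 2.
Proof.
move=> syme univ x y.
have conn : connect e x y.
  suff xc z : connect e z c.
    by apply: connect_trans (xc x) _; rewrite (sym_connect_sym syme).
  by have [->|/univ/connect1] := eqVneq z c.
have /walk_of_lengthP := dist_walk conn.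
have [<-|neqxy] := eqVneq x y.
  move=> _; apply/eqP; rewrite -leqn0; apply: dist_min.
  by apply/walk_of_lengthP; exists [::].
case exy: (e x y).
  have : dist e x y <= 1.
    by apply: dist_min; apply/walk_of_lengthP; exists [:: y]; rewrite /= exy.
  case: (dist e x y) => [_ [p [/size0nil -> _ /= eqxy]]|[]//].
  by rewrite eqxy eqxx in neqxy.
have : dist e x y <= 2.
  apply: dist_min; apply/walk_of_lengthP; exists [:: c; y]; split=> //=.
  (* An endpoint equal to [c] would be adjacent to the other one. *)
  have xc : x != c.
    by apply: contraFneq exy => xc; rewrite xc syme univ // -xc eq_sym.
  have yc : y != c.
    by apply: contraFneq exy => yc; rewrite yc univ // -yc.
  by rewrite univ //= syme univ.
case: (dist e x y) => [_ [p [/size0nil -> _ /= eqxy]]|[|[]//] _].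
  by rewrite eqxy eqxx in neqxy.
by case=> -[|z [|? ?]] [] //= _; rewrite andbT => exz eqzy; rewrite eqzy exy in exz.
Qed.

Section ComplementCone.

Variables (T : finType) (F : rel T).
Hypothesis symF : symmetric F.

(** [None] is the apex; the default [false] joins it to all other vertices. *)
Definition co_cone : rel (option T) := fun u v =>
  (u != v) && ~~ (if (u, v) is (Some x, Some y) then F x y else false).

Lemma co_cone_sym : symmetric co_cone.
Proof.
by move=> x y; rewrite /co_cone eq_sym; case: x y => [x|] [y|] //; rewrite symF.
Qed.

Lemma co_cone_irr : irreflexive co_cone.
Proof. by move=> x; rewrite /co_cone eqxx. Qed.

Lemma co_cone_universal x : x != None -> co_cone x None.
Proof. by case: x. Qed.

Lemma co_cone_connected : connected_graph co_cone.
Proof.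
have xN x : connect co_cone x None.
  by case: x => [x|] //; apply/connect1/co_cone_universal.
move=> x y; apply: connect_trans (xN x) _.
by rewrite (sym_connect_sym co_cone_sym).
Qed.

Lemma dist_co_cone x y :
  dist co_cone (Some x) (Some y) = if x == y then 0 else if F x y then 2 else 1.
Proof.
rewrite (dist_universal co_cone_sym co_cone_universal) /co_cone.
by rewrite (inj_eq Some_inj); case: eqP => //= _; case: (F x y).
Qed.

Lemma dist_co_cone_apex x : dist co_cone None x = (x != None).
Proof.
by rewrite (dist_universal co_cone_sym co_cone_universal); case: x.
Qed.

Lemma dist_to_co_cone_apex x : dist co_cone x None = (x != None).
Proof.
by rewrite (dist_universal co_cone_sym co_cone_universal); case: x.
Qed.

(** A member of [W] is recognised by its distance 0 to itself. Any other [Some u] is at distance 2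
    from its F-neighbours in [W] and 1 from the rest, so it looks like the apex exactly when it is
    undominated and the apex is not in [W]. *)
Lemma resolving_co_cone (W : {set option T}) :
  resolving co_cone W =
    locating F (Some @^-1: W) && ((None \in W) || dominating F (Some @^-1: W)).
Proof.
have neqW u w : Some u \notin W -> Some w \in W -> (u == w) = false.
  by move=> uW wW; apply: contraNF uW => /eqP ->.
apply/resolvingP/andP => [resW | [/locatingP loc dom]].
  split.
    apply/locatingP => u v; rewrite !inE => uW vW Fuv.
    apply: Some_inj; apply: resW => -[w|] wW; last by rewrite !dist_to_co_cone_apex.
    by rewrite !dist_co_cone Fuv ?inE // (neqW _ _ uW wW) (neqW _ _ vW wW).
  case NW: (None \in W) => //=; apply/forallP => u.
  apply: contraT; rewrite inE negb_or => /andP[uW nFu].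
  suff : Some u = None by [].
  apply: resW => -[w|] wW; last by rewrite wW in NW.
  rewrite dist_co_cone dist_co_cone_apex (neqW _ _ uW wW).
  rewrite ifN //; apply: contraNN nFu => Fuw.
  by apply/exists_inP; exists w; rewrite ?inE.
have apex u : {in W, forall w, dist co_cone (Some u) w = dist co_cone None w} ->
    False.
  move=> Du; case: (boolP (Some u \in W)) => [/Du|uW].
    by rewrite dist_co_cone eqxx dist_co_cone_apex.
  case/orP: dom => [/Du|/dominatingP/(_ u)].
    by rewrite dist_to_co_cone_apex dist_co_cone_apex.
  rewrite inE => /(_ uW)[w]; rewrite inE => /Du.
  rewrite dist_co_cone dist_co_cone_apex => + Fuw; rewrite Fuw.
  by case: eqP.
case=> [u|] [v|] // Duv; last first.
- by case: (apex v) => w wW; rewrite Duv.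
- by case: (apex u).
congr Some; case: (boolP (Some u \in W)) => [/Duv|uW].
  by rewrite !dist_co_cone eqxx; case: eqP => // _; case: (F v u).
case: (boolP (Some v \in W)) => [/Duv|vW].
  by rewrite !dist_co_cone eqxx; case: eqP => // _; case: (F u v).
apply: loc; rewrite ?inE // => w; rewrite inE => wW; have := Duv _ wW.
rewrite !dist_co_cone (neqW _ _ uW wW) (neqW _ _ vW wW).
by case: (F u w); case: (F v w).
Qed.

Lemma co_cone_unique_basis (W0 : {set T}) :
    tight_locating_dominating F W0 ->
  metric_dimension co_cone = #|W0| /\ exists! W, metric_basis co_cone W.
Proof.
move=> [loc0 dom0 min0].
have preW0 : Some @^-1: (Some @: W0) = W0.
  by apply/setP => x; rewrite inE mem_imset //; apply: Some_inj.
have NW0 : None \notin Some @: W0 by apply/negP => /imsetP[].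
have cardW0 : #|Some @: W0| = #|W0| by rewrite card_imset //; apply: Some_inj.
have res0 : resolving co_cone (Some @: W0).
  by rewrite resolving_co_cone preW0 loc0 dom0 orbT.
have minW W : resolving co_cone W -> #|W0| <= #|W| ?= iff (W == Some @: W0).
  rewrite resolving_co_cone => /andP[locW domW].
  have WD1 : W :\ None = Some @: (Some @^-1: W).
    apply/setP => -[x|]; rewrite !inE.
      by rewrite mem_imset ?inE //; apply: Some_inj.
    by apply/esym/negP => /imsetP[].
  have cardW : #|W| = #|Some @^-1: W| + (None \in W).
    by rewrite (cardsD1 None) WD1 card_imset 1?addnC //; apply: Some_inj.
  (* The equality cases of two chained bounds: tightness of [W0], then
     [~~ dominating <= (None \in W)]. As [W0] dominates, both hold only if the apex is absent. *)
  have -> : (W == Some @: W0) =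
      (Some @^-1: W == W0) && (~~ dominating F (Some @^-1: W) == (None \in W)).
    apply/eqP/andP => [->|[/eqP EW]]; first by rewrite preW0 dom0 (negbTE NW0).
    rewrite EW dom0 => /eqP NW; apply/setP => -[x|].
      by rewrite mem_imset -?EW ?inE //; apply: Some_inj.
    by rewrite (negbTE NW0) -NW.
  apply: leqif_trans (min0 _ locW) _; rewrite cardW.
  by move: domW; rewrite /leqif leq_add2l eqn_add2l;
     case: (None \in W); case: (dominating F _).
have basis0 : metric_basis co_cone (Some @: W0).
  rewrite /metric_basis res0; apply/forallP => W; apply/implyP => /minW le0W.
  by rewrite cardW0 le0W.
split.
  by move: basis0; rewrite metric_basis_card cardW0 => /andP[_ /eqP].
exists (Some @: W0); split=> // W /andP[/minW le0W /forallP/(_ (Some @: W0))].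
rewrite res0 cardW0 /= => leW0.
by apply/esym/eqP; rewrite -le0W.2 eqn_leq leW0 le0W.
Qed.

End ComplementCone.

(** * Finite verification for the two building blocks *)

Section ListGraph.

Variables (n : nat) (E : seq (nat * nat)) (s : seq nat).

Definition list_adj (i j : nat) := ((i, j) \in E) || ((j, i) \in E).

Definition list_rel : rel 'I_n := fun i j => list_adj i j.

(** With sets replaced by predicates on [nat] and quantifiers by [iota], domination and location in
    a concrete graph compute to Boolean formulas in [p 0], [p 1], and so on. *)
Definition list_dominating (p : pred nat) :=
  all (fun u => p u || has (fun w => p w && list_adj u w) (iota 0 n)) (iota 0 n).

Definition list_locating (p : pred nat) :=
  all (fun u => all (fun v =>
    [&& ~~ p u, ~~ p v &
        all (fun w => p w ==> (list_adj u w == list_adj v w)) (iota 0 n)]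
      ==> (u == v)) (iota 0 n)) (iota 0 n).

Lemma forall_ord_iota (P : pred nat) : [forall i : 'I_n, P i] = all P (iota 0 n).
Proof.
apply/forallP/allP => [PI i | Ps i]; last by apply: Ps; rewrite mem_iota ltn_ord.
by rewrite mem_iota => ltin; apply: (PI (Ordinal ltin)).
Qed.

Lemma exists_ord_iota (P : pred nat) : [exists i : 'I_n, P i] = has P (iota 0 n).
Proof.
apply/existsP/hasP => [[i Pi] | [i]]; first by exists (val i); rewrite ?mem_iota ?ltn_ord.
by rewrite mem_iota => ltin Pi; exists (Ordinal ltin).
Qed.

Lemma list_tight_locating_dominating :
    list_dominating (mem s) -> list_locating (mem s) ->
    (forall p : pred nat, list_locating p ->
       count (mem s) (iota 0 n) <= count p (iota 0 n) + ~~ list_dominating p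
         ?= iff all (fun i => p i == (i \in s)) (iota 0 n)) ->
  tight_locating_dominating list_rel [set i : 'I_n | val i \in s].
Proof.
move=> dom_s loc_s min_s.
have domE (W : {set 'I_n}) (p : pred nat) : (forall i : 'I_n, (i \in W) = p i) ->
    dominating list_rel W = list_dominating p.
  move=> Wp; rewrite /list_dominating -forall_ord_iota.
  apply: eq_forallb => u; rewrite Wp -exists_ord_iota; congr (_ || _).
  by apply: eq_existsb => w; rewrite Wp.
have locE (W : {set 'I_n}) (p : pred nat) : (forall i : 'I_n, (i \in W) = p i) ->
    locating list_rel W = list_locating p.
  move=> Wp; rewrite /list_locating -forall_ord_iota.
  apply: eq_forallb => u; rewrite -forall_ord_iota.
  apply: eq_forallb => v; rewrite !Wp -forall_ord_iota.
  congr ([&& _, _ & _] ==> _).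
  by apply: eq_forallb => w; rewrite Wp.
have cardE (W : {set 'I_n}) (p : pred nat) : (forall i : 'I_n, (i \in W) = p i) ->
    #|W| = count p (iota 0 n).
  move=> Wp; rewrite -sum1_card -sum1_count -[in RHS](subn0 n) -/(index_iota 0 n).
  by rewrite big_mkord; apply: eq_bigl.
have W0E i : (i \in [set i : 'I_n | val i \in s]) = (val i \in s).
  by rewrite inE.
split; [by rewrite (locE _ (mem s)) | by rewrite (domE _ (mem s)) |].
move=> W; pose p i := i \in [seq val j | j in W].
have Wp (i : 'I_n) : (i \in W) = p i.
  by rewrite /p mem_map ?mem_enum //; apply: val_inj.
rewrite (locE _ _ Wp) (domE _ _ Wp) (cardE _ _ Wp) (cardE _ _ W0E).
move=> /min_s; congr (leqif _ _ _).
rewrite -forall_ord_iota; apply/forallP/eqP => [pE | WE i].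
  by apply/setP => i; rewrite Wp (eqP (pE i)) inE.
by rewrite -Wp WE inE.
Qed.

End ListGraph.

Definition path5 := [:: (0, 1); (1, 2); (2, 3); (3, 4)].

(** A truth table over all 32 vertex subsets. *)
Lemma path5_tight :
  tight_locating_dominating (list_rel (n := 5) path5)
    [set i : 'I_5 | val i \in [:: 1; 3]].
Proof.
apply: list_tight_locating_dominating => // p.
rewrite /leqif /list_locating /list_dominating /=.
by case: (p 0); case: (p 1); case: (p 2); case: (p 3); case: (p 4).
Qed.

(* The path 0 - 1 - ... - 6 with the pendant vertex 7 attached to 3.          *)
Definition spider8 :=
  [:: (0, 1); (1, 2); (2, 3); (3, 4); (4, 5); (5, 6); (3, 7)].

Lemma spider8_tight :
  tight_locating_dominating (list_rel (n := 8) spider8)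
    [set i : 'I_8 | val i \in [:: 1; 3; 5]].
Proof.
apply: list_tight_locating_dominating => // p.
rewrite /leqif /list_locating /list_dominating /=.
by case: (p 0); case: (p 1); case: (p 2); case: (p 3);
   case: (p 4); case: (p 5); case: (p 6); case: (p 7).
Qed.

Lemma list_rel_sym n E : symmetric (@list_rel n E).
Proof. by move=> i j; rewrite /list_rel /list_adj orbC. Qed.

(** * Assembly for every k *)

(** The last equation says that the order is 5k/2 rounded up; the apex later contributes the
    remaining 1. *)
Lemma tight_locating_dominating_exists k : 2 <= k ->
  exists (T : finType) (F : rel T) (W : {set T}),
    [/\ symmetric F, tight_locating_dominating F W, #|W| = k &
        #|T|.*2 = 5 * k + odd k].
Proof.
have card_list n s : uniq s -> {subset s <= iota 0 n} ->
    #|[set i : 'I_n | val i \in s]| = size s.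
  move=> uniq_s sub_s; rewrite cardE -(size_map val); apply/perm_size.
  apply: uniq_perm => //; first by rewrite map_inj_uniq ?enum_uniq //; apply: val_inj.
  move=> i; apply/mapP/idP => [[j] | si]; first by rewrite mem_enum inE => ? ->.
  have := sub_s i si; rewrite mem_iota => ltin.
  by exists (Ordinal ltin); rewrite // mem_enum inE.
(* Induction in steps of two from 2 and 3: each further [path5] adds 2 to the size and 5 to the
   order, preserving parity. *)
elim/ltn_ind: k => -[|[|[|[|k]]]] // IH _.
- exists 'I_5, (@list_rel 5 path5), [set i : 'I_5 | val i \in [:: 1; 3]].
  rewrite card_list // ?card_ord; last by apply/allP.
  by split; [apply: list_rel_sym | apply: path5_tight | |].
- exists 'I_8, (@list_rel 8 spider8), [set i : 'I_8 | val i \in [:: 1; 3; 5]].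
  rewrite card_list // ?card_ord; last by apply/allP.
  by split; [apply: list_rel_sym | apply: spider8_tight | |].
have [||T [F [W [symF tightF cardW cardT]]]] := IH k.+2; [lia | lia |].
have [V tightV cardV] := sum_tight_locating_dominating tightF path5_tight.
exists (T + 'I_5)%type, (sum_rel F (@list_rel 5 path5)), V; split=> //.
- exact/sum_rel_sym/list_rel_sym.
- by rewrite cardV cardW card_list //; [rewrite addn2 | apply/allP].
by rewrite card_sum card_ord; move: cardT; rewrite /= !negbK; lia.
Qed.

Theorem theorem8 (k : nat) (hk : 2 <= k) :
  exists (T : finType) (e : rel T),
    [/\ symmetric e,
        irreflexive e,
        connected_graph e,
        (#|T| : int) = Num.ceil (5%:R * k%:R / 2%:R + 1 : rat)%R &
        metric_dimension e = k /\
        exists! W : {set T}, metric_basis e W].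
Proof.
have [T [F [W [symF tightF cardW cardT]]]] := tight_locating_dominating_exists hk.
exists (option T), (co_cone F); split.
- exact: co_cone_sym.
- exact: co_cone_irr.
- exact: co_cone_connected.
(* Here 5k/2 + 1 falls short of [#|T|] + 1 by 0 or 1/2, depending on the parity of [k]. *)
- apply/esym/ceil_def; rewrite card_option.
  have : (#|T|%:R * 2%:R = 5%:R * k%:R + (odd k)%:R :> rat)%R.
    by rewrite -!natrM -natrD muln2 cardT.
  rewrite intrB -!pmulrn -[#|T|.+1%:R%R]natr1; case: (odd k) => /= H; apply/andP; split; lra.
- by rewrite -cardW; apply: co_cone_unique_basis.
Qed.
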